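(* Let $d\ge1$ be an integer, let $k$ be an integer with $n\le k\le d$, and let $\mathbf u\in\operatorname{comp}(k,n)$. If $s=\inf\{e\ge1:[kp^e\,\%\,d]<n\}$, then $$\operatorname{crit}(\mathfrak m^d,\mathbf u)=\frac kd-\frac{[kp^s\,\%\,d]}{d\,p^s},$$ where this formula is interpreted to agree with $k/d$ if $s=\infty$. In particular, $\operatorname{crit}(\mathfrak m^d,\mathbf u)$ depends only on $k$, but not on the point $\mathbf u\in\operatorname{comp}(k,n)$.
   Context: $p$ is a prime, $\Bbbk$ is a field of characteristic $p$ with $[\Bbbk:\Bbbk^p]<\infty$, $n\ge1$, $R=\Bbbk[x_1,\dots,x_n]$, $\mathfrak m=\langle x_1,\dots,x_n\rangle$. For integers $m$ and $d\ge1$, $[m\,\%\,d]$ is the least positive residue of $m$ modulo $d$ (an element of $\{1,\dots,d\}$). $\operatorname{comp}(k,n)$ is the set of $\mathbf u\in\mathbb N^n$ with all coordinates positive and $u_1+\cdots+u_n=k$. For $\mathbf u\in\mathbb N^n$ with positive coordinates, $\operatorname{diag}(\mathbf u)=\langle x_1^{u_1},\dots,x_n^{u_n}\rangle$. For an ideal $\mathfrak b$ and $e\ge0$, $\mathfrak b^{[p^e]}=\langle f^{p^e}:f\in\mathfrak b\rangle$. If $m\in\mathbb N$ has base $p$ expansion $m=m_0+m_1p+\cdots+m_rp^r$, the Frobenius power is $\mathfrak a^{[m]}=\mathfrak a^{m_0}(\mathfrak a^{m_1})^{[p]}\cdots(\mathfrak a^{m_r})^{[p^r]}$. For a nonzero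 proper ideal $\mathfrak a$ and a proper ideal $\mathfrak b$ with $\mathfrak a\subseteq\sqrt{\mathfrak b}$, and $q=p^e$, $\mu(\mathfrak a,\mathfrak b,q)=\max\{m\in\mathbb N:\mathfrak a^{[m]}\not\subseteq\mathfrak b^{[q]}\}$ and $\operatorname{crit}(\mathfrak a,\mathfrak b)=\lim_{q\to\infty}\mu(\mathfrak a,\mathfrak b,q)/q$ (the limit exists). We write $\operatorname{crit}(\mathfrak a,\mathbf u)$ for $\operatorname{crit}(\mathfrak a,\operatorname{diag}(\mathbf u))$. *)

(* Defs.v *)
From HB Require Import structures.
From mathcomp Require Import all_boot all_order all_algebra.
From mathcomp Require Import boolp classical_sets reals topology normedtype sequences.
(* The notations of mpoly clash with those of topology. *)
From mathcomp Require mpoly.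
Import -(notations) mpoly.

Set Implicit Arguments.
Unset Strict Implicit.
Unset Printing Implicit Defensive.

Import Order.TTheory GRing.Theory Num.Theory.
Import numFieldNormedType.Exports.

Local Open Scope classical_set_scope.
Local Open Scope ring_scope.

Section Ideals.
Variable A : comNzRingType.
Implicit Types (I J a b : set A) (p q m : nat).

(* The whole ring is allowed, unlike with [idealr_closed]. *)
Definition is_ideal I : Prop :=
  [/\ I 0, forall f g, I f -> I g -> I (f + g) & forall f g, I g -> I (f * g)].

Definition ideal_gen (S : set A) : set A := smallest is_ideal S.

Definition ideal_mul I J : set A :=
  ideal_gen [set h | exists f g, [/\ I f, J g & h = f * g]].

Definition ideal_exp I m : set A := iter m (ideal_mul I) setT.

(* I^[q], for q a power of the characteristic *)
Definition bracket_power I q : set A := ideal_gen [set f ^+ q | f in I].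

Definition digit p m i : nat := ((m %/ p ^ i) %% p)%N.

(* a^[m] for an arbitrary natural number m, from its base p expansion; the
   top digit has index r = trunc_log p m *)
Definition frob_power p a m : set A :=
  \big[ideal_mul/setT]_(i < (trunc_log p m).+1)
    bracket_power (ideal_exp a (digit p m i)) (p ^ i).

(* Maximum of a set of naturals; junk value 0 if there is none *)
Definition nat_max (S : set nat) : nat :=
  xget 0%N [set m | S m /\ forall m', S m' -> (m' <= m)%N].

Definition mu p a b q : nat :=
  nat_max [set m | ~ (frob_power p a m `<=` bracket_power b q)].

Definition crit_seq (R : realType) p a b : R^nat :=
  fun e => (mu p a b (p ^ e))%:R / (p ^ e)%:R.

Definition crit (R : realType) p a b : R := limn (crit_seq R p a b).

End Ideals.

Section Polynomials.
Variables (K : fieldType) (n : nat).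

Definition polyring : comNzRingType := mpoly.mpoly n K.

Definition indet (i : 'I_n) : polyring := mpoly.mpolyX K (mpoly.mnm1 i).

Definition max_ideal : set polyring := ideal_gen (range indet).

Definition diag (u : 'I_n -> nat) : set polyring :=
  ideal_gen (range (fun i => indet i ^+ u i)).

End Polynomials.
Arguments indet K {n} i.
Arguments max_ideal : clear implicits.
Arguments diag K {n} u _.

(* [K : K^p] is finite: a finite family spans K over its subfield K^p. *)
Definition finite_over_frobenius (p : nat) (K : fieldType) : Prop :=
  exists (r : nat) (b : 'I_r -> K), forall x : K,
    exists c : 'I_r -> K, x = \sum_(i < r) c i ^+ p * b i.

Definition compositions (k n : nat) : set ('I_n -> nat) :=
  [set u | (forall i, (0 < u i)%N) /\ (\sum_(i < n) u i)%N = k].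

(* Least positive residue of m modulo d, in {1, ..., d} *)
Definition lpr (m d : nat) : nat := if (d %| m)%N then d else (m %% d)%N.

(* Infimum of a set of naturals; None stands for infinity. *)
Definition nat_inf (S : set nat) : option nat :=
  if pselect (exists e, `[< S e >]) is left h then Some (ex_minn h) else None.

Definition crit_formula (R : realType) (p d k : nat) (s : option nat) : R :=
  if s is Some e then k%:R / d%:R - (lpr (k * p ^ e) d)%:R / (d * p ^ e)%:R
  else k%:R / d%:R.

(* Main.v *)
Require Import Defs.
From HB Require Import structures.
From mathcomp Require Import all_boot all_order all_algebra.
From mathcomp Require Import boolp classical_sets reals topology normedtype sequences.
From mathcomp Require Import zify ring.
From mathcomp Require mpoly.
Import -(notations) mpoly.

Import Order.TTheory GRing.Theory Num.Theory.
Import numFieldNormedType.Exports.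

Local Open Scope classical_set_scope.
Local Open Scope ring_scope.

(* All ideals involved are monomial, so (m^d)^[M] is not contained in
   diag(u)^[p^e] iff there are exponent vectors v_i, of degree d times the i-th
   base p digit of M, such that sum_i p^i v_i is coordinatewise less than
   p^e u.  Write r_e = [k p^e % d] and k p^e = d m_e + r_e.
   Keeping only the digits of M from position f on divides M and the exponent
   vector by p^f; comparing degrees gives d floor(M / p^f) + n <= k p^(e - f).
   Conversely the slack p^e u - sum_i p^i v_i can be built digit by digit: from a
   positive vector t one can pass to any positive t' <= p t, and such a t' exists
   for each prescribed degree between n and p |t|.  As long as r_e >= n this
   reaches M = m_e with slack of degree r_e; at the first s with r_s < n the last
   digit is lowered by one and all later digits are p - 1.  Hence
   mu(p^e) = m_e for e < s and mu(p^e) = m_s p^(e - s) - 1 for e >= s. *)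

(** * Membership in products, powers and bracket powers of ideals *)

Section Ideals.
Set Implicit Arguments.
Unset Strict Implicit.
Variable A : comNzRingType.
Implicit Types (I J S : set A) (f g : A).

Lemma ideal_gen_ideal S : is_ideal (ideal_gen S).
Proof.
split=> [T [[T0 _ _] _] //|f g If Ig T T_S|f g Ig T T_S].
  by case: (T_S) => -[_ TD _] _; apply: TD; [exact: If|exact: Ig].
by case: (T_S) => -[_ _ TM] _; apply: TM; exact: Ig.
Qed.

Lemma mem_ideal_gen S f : S f -> ideal_gen S f.
Proof. by move=> Sf T [_]; apply. Qed.

Lemma ideal_gen_sub S I : is_ideal I -> S `<=` I -> ideal_gen S `<=` I.
Proof. by move=> idI SI f; apply. Qed.

Lemma mem_ideal_mul I J f g : I f -> J g -> ideal_mul I J (f * g).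
Proof. by move=> If Jg; apply: mem_ideal_gen; exists f, g. Qed.

Lemma mem_ideal_exp I (s : seq A) :
  (forall f, f \in s -> I f) -> ideal_exp I (size s) (\prod_(f <- s) f).
Proof.
elim: s => [|f s IHs] Is; first by [].
rewrite big_cons; apply: mem_ideal_mul; first by apply: Is; rewrite mem_head.
by apply: IHs => g gs; apply: Is; rewrite in_cons gs orbT.
Qed.

Lemma mem_ideal_exp_exp I (s : seq A) (c d : nat) :
  size s = (c * d)%N -> (forall f, f \in s -> I f) ->
  ideal_exp (ideal_exp I d) c (\prod_(f <- s) f).
Proof.
elim: c s => [|c IHc] s sz Is; first by [].
rewrite -(cat_take_drop d s) big_cat /=.
have le_d : (d <= size s)%N by rewrite sz leq_addr.
apply: mem_ideal_mul; last first.
  apply: IHc => [|f fs]; first by rewrite size_drop sz mulSn addKn.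
  by apply: Is; exact: mem_drop fs.
rewrite -{1}(size_takel le_d); apply: mem_ideal_exp => f fs.
by apply: Is; exact: mem_take fs.
Qed.

Lemma mem_bracket_power I (q : nat) f : I f -> bracket_power I q (f ^+ q).
Proof. by move=> If; apply: mem_ideal_gen; exists f. Qed.

Lemma mem_big_ideal_mul (N : nat) (I : 'I_N -> set A) (f : 'I_N -> A) :
  (forall i, I i (f i)) -> (\big[@ideal_mul A/setT]_(i < N) I i) (\prod_(i < N) f i).
Proof.
move=> If; apply: (big_ind2 (fun (J : set A) (g : A) => J g)) => //.
by move=> J g J' g'; exact: mem_ideal_mul.
Qed.

End Ideals.

(** * Monomial bounds on Frobenius powers and on diagonal ideals *)

Section MonomialSupport.
Set Implicit Arguments.
Unset Strict Implicit.
Variables (K : fieldType) (n : nat).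
Local Notation mn := (multinom n).
Local Notation X := (@mpolyX n K).
Implicit Types (P Q : mn -> Prop) (I J : set (polyring K n)) (m v w : mn).

(** For [P] stable under increasing coordinates, this is the monomial ideal spanned by the monomials
    with exponent in [P]. Containments in such sets turn ideal membership into conditions on
    exponents. *)
Definition supp_in P : set (polyring K n) :=
  [set f | forall m, m \in msupp f -> P m].

Definition upward P := forall m w, P m -> (forall j, (m j <= w j)%N) -> P w.

Lemma supp_in_ideal P : upward P -> is_ideal (supp_in P).
Proof.
move=> upP; split=> [m|f g If Ig m|f g Ig m]; first by rewrite msupp0.
  by move/msuppD_le; rewrite mem_cat => /orP[/If|/Ig].
move=> /msuppM_le /allpairsP[[m1 m2] [/= m1f m2g ->]].
by apply: (upP m2); [exact: Ig|move=> j; rewrite mnmDE leq_addl].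
Qed.

Lemma supp_in_mpolyX P m : supp_in P (X m) <-> P m.
Proof.
split=> [|Pm m']; first by apply; rewrite msuppX mem_seq1.
by rewrite msuppX mem_seq1 => /eqP ->.
Qed.

Lemma mpoly_ind_supp (T : mpoly n K -> Prop) f :
  T 0 -> (forall g h, T g -> T h -> T (g + h)) ->
  (forall c m, m \in msupp f -> T (c *: X m)) -> T f.
Proof.
move=> T0 TD TX; rewrite (mpolyE f) big_seq_cond.
by apply: big_ind => // m /andP[mf _]; exact: TX.
Qed.

Lemma supp_in_sub P I : is_ideal I -> (forall m, P m -> I (X m)) ->
  supp_in P `<=` I.
Proof.
move=> [I0 ID IM] PI f Pf; apply: (@mpoly_ind_supp I) => // c m mf.
by rewrite -mul_mpolyC; apply: IM; exact: PI (Pf m mf).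
Qed.

(** In characteristic [p] raising to the power [p ^ e] is additive, so [f ^+ (p ^ e)] is a
    combination of the [p ^ e]-th powers of the monomials of [f]. *)
Lemma bracket_power_supp p e P I : p \in [pchar K] -> I `<=` supp_in P ->
  bracket_power I (p ^ e) `<=`
  supp_in (fun w => exists v, P v /\ forall j, (v j * p ^ e <= w j)%N).
Proof.
move=> charK IP; set Q := (fun w => _).
have upQ : upward Q.
  move=> m w [v [Pv vm]] mw; exists v; split=> // j.
  exact: leq_trans (vm j) (mw j).
have [Q0 QD QM] := supp_in_ideal upQ.
apply: ideal_gen_sub => // _ [f /IP Pf <-].
apply: (@mpoly_ind_supp (fun g => supp_in Q (g ^+ (p ^ e)))).
- by rewrite expr0n expn_eq0 -leqn0 leqNgt prime_gt0 ?(pcharf_prime charK).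
- move=> g h Qg Qh; rewrite exprDn_pchar; first exact: QD.
  rewrite pnatX; apply/orP; left; rewrite pnatE ?(pcharf_prime charK) //.
  by rewrite (@pchar_lalg K (mpoly n K)).
- move=> c m mf; rewrite exprZn mpolyXn -mul_mpolyC; apply: QM.
  apply/supp_in_mpolyX; exists m; split; first exact: Pf.
  by move=> j; rewrite mulmnE.
Qed.

Lemma ideal_mul_supp P Q I J : I `<=` supp_in P -> J `<=` supp_in Q ->
  ideal_mul I J `<=`
  supp_in (fun w => exists v v', [/\ P v, Q v' & forall j, (v j + v' j <= w j)%N]).
Proof.
move=> IP JQ; apply: ideal_gen_sub.
  apply: supp_in_ideal => m w [v [v' [Pv Qv' vm]]] mw; exists v, v'; split=> // j.
  exact: leq_trans (vm j) (mw j).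
move=> _ [f [g [/IP Pf /JQ Qg ->]]] m /msuppM_le /allpairsP[[m1 m2] [/= m1f m2g ->]].
exists m1, m2; split; [exact: Pf|exact: Qg|by move=> j; rewrite mnmDE].
Qed.

Lemma leq_mdeg m w : (forall j, (m j <= w j)%N) -> (mdeg m <= mdeg w)%N.
Proof. by move=> mw; rewrite !mdegE; apply: leq_sum => j _; exact: mw. Qed.

Lemma ideal_exp_supp D c I : I `<=` supp_in (fun w => (D <= mdeg w)%N) ->
  ideal_exp I c `<=` supp_in (fun w => (c * D <= mdeg w)%N).
Proof.
move=> ID; elim: c => [|c IHc]; first by move=> f _ m _.
move=> f /(ideal_mul_supp ID IHc) Hf m /Hf [v [v' [Dv Dv' le_m]]].
rewrite mulSn (leq_trans (leq_add Dv Dv')) // -mdegD.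
by apply: leq_mdeg => j; rewrite mnmDE.
Qed.

(** The families are indexed by all naturals, so that the induction on [N] can split off index 0 and
    shift the others. *)
Lemma big_ideal_mul_supp (N : nat) (I : nat -> set (polyring K n))
    (Q : nat -> mn -> Prop) :
  (forall i, I i `<=` supp_in (Q i)) ->
  \big[@ideal_mul (polyring K n)/setT]_(i < N) I i `<=`
  supp_in (fun w => exists v : nat -> mn,
    (forall i, (i < N)%N -> Q i (v i)) /\
    forall j, (\sum_(i < N) v i j <= w j)%N).
Proof.
elim: N I Q => [|N IHN] I Q IQ.
  by move=> f _ m _; exists (fun=> @mnm0 n); split=> // j; rewrite big_ord0.
rewrite big_ord_recl => f Hf m mf.
have [] := ideal_mul_supp (IQ 0%N) (IHN (fun i => I i.+1) _ (fun i => IQ i.+1)) Hf mf.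
move=> v [v' [Qv [v2 [Qv2 le_v'] le_m]]].
exists (fun i => if i is i'.+1 then v2 i' else v); split=> [[|i] //|j].
  exact: Qv2.
rewrite big_ord_recl /=; apply: leq_trans (le_m j).
by rewrite leq_add2l; exact: le_v'.
Qed.

Lemma max_ideal_supp : max_ideal K n `<=` supp_in (fun w => (1 <= mdeg w)%N).
Proof.
apply: ideal_gen_sub; first by apply: supp_in_ideal => m w m1 /leq_mdeg; exact: leq_trans.
by move=> _ [i _ <-]; apply/supp_in_mpolyX; rewrite mdeg1.
Qed.

Lemma mpolyX_indets m :
  exists s : seq 'I_n, size s = mdeg m /\ X m = \prod_(i <- s) X (mnm1 i).
Proof.
exists (flatten [seq nseq (m i) i | i <- index_enum 'I_n]); split.
  rewrite size_flatten /shape -map_comp sumnE big_map mdegE.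
  by apply: eq_bigr => i _ /=; rewrite size_nseq.
rewrite mpolyXE_id big_flatten big_map; apply: eq_bigr => i _.
by rewrite big_nseq -Monoid.iteropE.
Qed.

Lemma mpolyX_max_ideal d c m : mdeg m = (c * d)%N ->
  ideal_exp (ideal_exp (max_ideal K n) d) c (X m).
Proof.
move=> deg_m; have [s [sz ->]] := mpolyX_indets m.
rewrite -(big_map (fun i => X (mnm1 i)) predT id).
apply: (@mem_ideal_exp_exp (polyring K n)) => [|f /mapP[i _ ->]].
  by rewrite size_map sz.
by apply: mem_ideal_gen; exists i.
Qed.

Lemma diag_bracket_mpolyX (u : 'I_n -> nat) q m j : (u j * q <= m j)%N ->
  bracket_power (diag K u) q (X m).
Proof.
move=> le_m; set k := mnm_muln (mnm1 j) (u j * q).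
have -> : m = mnm_add (mnm_sub m k) k.
  apply/mnmP => i; rewrite mnmDE mnmBE subnK // mulmnE mnm1E.
  by case: eqP => [<-|_]; rewrite ?mul1n.
rewrite mpolyXD; have [_ _] := ideal_gen_ideal [set f ^+ q | f in diag K u].
apply; rewrite -mpolyXn exprM; apply: mem_bracket_power.
by apply: mem_ideal_gen; exists j.
Qed.

Lemma diag_bracket_supp p e (u : 'I_n -> nat) : p \in [pchar K] ->
  bracket_power (diag K u) (p ^ e) `<=`
  supp_in (fun w => exists j, (u j * p ^ e <= w j)%N).
Proof.
move=> charK; have uP : diag K u `<=` supp_in (fun w => exists j, (u j <= w j)%N).
  apply: ideal_gen_sub.
    by apply: supp_in_ideal => m w [j uj] mw; exists j; exact: leq_trans (mw j).
  move=> _ [j _ <-]; rewrite /indet mpolyXn; apply/supp_in_mpolyX; exists j.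
  by rewrite mulmnE mnm1E eqxx mul1n.
move=> f /(bracket_power_supp charK uP) Hf m /Hf[v [[j uv] vm]].
by exists j; apply: leq_trans (vm j); rewrite leq_mul2r uv orbT.
Qed.

(** The witness is the monomial with exponent [\sum_i p^i v_i]. The degree of [v i] lets its i-th
    factor be cut into the required number of products of [d] indeterminates, and no coordinate of
    the exponent reaches [p^e u]. *)
Lemma frob_power_not_sub p e d M (u : 'I_n -> nat) (v : nat -> mn) :
  p \in [pchar K] ->
  (forall i, mdeg (v i) = (digit p M i * d)%N) ->
  (forall N j, (\sum_(i < N) v i j * p ^ i < u j * p ^ e)%N) ->
  ~ (frob_power p (ideal_exp (max_ideal K n) d) M `<=`
     bracket_power (diag K u) (p ^ e)).
Proof.
move=> charK deg_v lt_u sub; set N := (trunc_log p M).+1.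
set w := \big[@mnm_add n/@mnm0 n]_(i < N) mnm_muln (v i) (p ^ i).
have Xw : frob_power p (ideal_exp (max_ideal K n) d) M (X w).
  rewrite /w -mprodXnE /frob_power.
  apply: (@mem_big_ideal_mul (polyring K n)) => i.
  apply: (@mem_bracket_power (polyring K n)); exact: mpolyX_max_ideal.
have /supp_in_mpolyX[j] := diag_bracket_supp charK (sub _ Xw).
rewrite mnm_sumE leqNgt => /negP; apply; apply: leq_ltn_trans (lt_u N j).
by apply: eq_leq; apply: eq_bigr => i _; rewrite mulmnE.
Qed.

(** By contraposition: if no such family exists, every monomial that can occur in the Frobenius
    power is divisible by some [x_j ^ (u j * q)]. *)
Lemma not_frob_power_sub p q d M (u : 'I_n -> nat) : p \in [pchar K] ->
  ~ (frob_power p (ideal_exp (max_ideal K n) d) M `<=`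
     bracket_power (diag K u) q) ->
  exists v : nat -> mn,
    (forall i, (i < (trunc_log p M).+1)%N -> (digit p M i * d <= mdeg (v i))%N) /\
    forall j, (\sum_(i < (trunc_log p M).+1) v i j * p ^ i < u j * q)%N.
Proof.
move=> charK; set N := (trunc_log p M).+1 => nsub; apply: contrapT => nex.
apply: nsub; set md := ideal_exp (max_ideal K n) d.
have md_supp : md `<=` supp_in (fun w => (d <= mdeg w)%N).
  by move=> f /(ideal_exp_supp max_ideal_supp) Hf m /Hf; rewrite muln1.
move=> f /(@big_ideal_mul_supp N
  (fun i => bracket_power (ideal_exp md (digit p M i)) (p ^ i)) _
  (fun i => bracket_power_supp charK (ideal_exp_supp md_supp))) Hf.
apply: (supp_in_sub (ideal_gen_ideal _) _ Hf) => w [v [Qv le_w]].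
(* The exponent [v i] only dominates [p ^ i] times a vector of large enough degree; that vector is
   chosen for [i < N], and beyond [N] any value will do. *)
have /choice[v' v'P] : forall i, exists x : mn, (i < N)%N ->
    (digit p M i * d <= mdeg x)%N /\ forall j, (x j * p ^ i <= v i j)%N.
  move=> i; have [/Qv[x Hx]|_] := ltnP i N; first by exists x.
  by exists (v i).
apply: contrapT => ninb; apply: nex; exists v'; split=> [i iN|j].
  by have [] := v'P _ iN.
rewrite ltnNge; apply/negP => le_u; apply: ninb.
apply: (@diag_bracket_mpolyX u q w j); apply: leq_trans le_u _.
apply: leq_trans (le_w j); apply: leq_sum => i _.
by have [_] := v'P _ (ltn_ord i).
Qed.

End MonomialSupport.

(** * Least positive residues and base p digits *)

Section Residues.
Set Implicit Arguments.
Unset Strict Implicit.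
Implicit Types (d k m p e : nat).

Lemma lpr_gt0 m d : (0 < d)%N -> (0 < lpr m d)%N.
Proof. by rewrite /lpr; case: ifP => // ndvd _; rewrite lt0n -/(dvdn d m) ndvd. Qed.

Lemma lpr_le m d : (0 < d)%N -> (lpr m d <= d)%N.
Proof. by rewrite /lpr; case: ifP => // _ /(ltn_pmod m)/ltnW. Qed.

(** A positive multiple of [d] is at least [d], so the truncated subtraction is exact also when the
    residue is [d]. *)
Lemma lpr_divn_eq m d : (0 < m)%N ->
  m = ((m - lpr m d) %/ d * d + lpr m d)%N.
Proof.
move=> m_gt0; rewrite /lpr; case: ifP => [dvd|_].
  by rewrite divnK ?dvdn_sub // subnK // dvdn_leq.
have dvd : (d %| m - m %% d)%N by rewrite -{1}(eqn_mod_dvd d (leq_mod m d)) modn_mod.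
by rewrite divnK // subnK // leq_mod.
Qed.

Lemma lpr_small k d : (0 < k <= d)%N -> lpr k d = k.
Proof.
move=> /andP[k_gt0]; rewrite /lpr leq_eqVlt => /orP[/eqP ->|lt_kd].
  by rewrite dvdnn.
by rewrite gtnNdvd // modn_small.
Qed.

Lemma digit0 p M c : (c < p)%N -> digit p (p * M + c) 0 = c.
Proof. by move=> cp; rewrite /digit expn0 divn1 mulnC modnMDl modn_small. Qed.

Lemma digitS p M c i : (c < p)%N -> digit p (p * M + c) i.+1 = digit p M i.
Proof.
move=> cp; rewrite /digit expnS divnMA mulnC divnMDl ?(divn_small cp) ?addn0 //.
exact: leq_ltn_trans (leq0n c) cp.
Qed.

Lemma sum_digits p M f N : (0 < p)%N -> (M < p ^ N)%N ->
  (\sum_(f <= i < N) digit p M i * p ^ (i - f))%N = (M %/ p ^ f)%N.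
Proof.
move=> p_gt0 M_lt; have [le_fN|/ltnW le_Nf] := leqP f N; last first.
  by rewrite big_geq // divn_small // (leq_trans M_lt) // leq_pexp2l.
(* Adding the contribution of the digits from [N] on removes the bound on [M], which makes induction
   on [N] possible. *)
have : (\sum_(f <= i < N) digit p M i * p ^ (i - f) +
    M %/ p ^ N * p ^ (N - f))%N = (M %/ p ^ f)%N.
  elim: N le_fN {M_lt} => [|N IHN].
    by rewrite leqn0 => /eqP ->; rewrite big_geq // muln1.
  rewrite leq_eqVlt => /orP[/eqP <-|]; first by rewrite big_geq // subnn muln1.
  rewrite ltnS => le_fN; rewrite big_nat_recr //= -[RHS]IHN // -addnA; congr (_ + _)%N.
  rewrite subSn // !expnS mulnA -mulnDl; congr (_ * _)%N.
  by rewrite /digit addnC mulnC [X in (M %/ X)%N]mulnC divnMA mulnC -divn_eq.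
by rewrite (divn_small M_lt) mul0n addn0.
Qed.

End Residues.

(** * Positive vectors of prescribed degree and the values of mu *)

(** Coordinates are lowered one unit at a time: while the sum exceeds [T >= n], some coordinate
    exceeds 1. The induction is on a bound [x] for the number of units to remove. *)
Lemma positive_below (n T : nat) (t : 'I_n -> nat) :
  (forall j, (0 < t j)%N) -> (n <= T)%N -> (T <= \sum_(j < n) t j)%N ->
  exists t' : 'I_n -> nat,
    [/\ forall j, (0 < t' j)%N, forall j, (t' j <= t j)%N & (\sum_(j < n) t' j)%N = T].
Proof.
move=> + le_nT; move: {2}(\sum_(j < n) t j - T)%N (leqnn (\sum_(j < n) t j - T)) => x.
elim: x t => [|x IHx] t le_x t_gt0 le_T.
  exists t; split=> //; apply/eqP; rewrite eqn_leq le_T andbT.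
  by rewrite -subn_eq0 -leqn0.
have [eqT|ltT] := leqP (\sum_(j < n) t j) T.
  by exists t; split=> //; apply/eqP; rewrite eqn_leq le_T eqT.
have [j t_j] : exists j, (1 < t j)%N.
  apply/existsP; apply: contraLR ltT; rewrite negb_exists => /forallP t_le.
  rewrite -leqNgt; apply: leq_trans le_nT.
  apply: (@leq_trans (\sum_(j < n) 1)%N); last by rewrite sum1_card card_ord.
  by apply: leq_sum => j _; rewrite leqNgt.
pose t1 i := if i == j then (t j).-1 else t i.
have sum_t1 : (\sum_(i < n) t i = (\sum_(i < n) t1 i).+1)%N.
  rewrite (bigD1 j) //= [in RHS](bigD1 j) //= {1}/t1 eqxx -addSn prednK; last exact: ltnW.
  by congr (_ + _)%N; apply: eq_bigr => i /negbTE ij; rewrite /t1 ij.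
have [|i||t' [t'_gt0 t'_le sum_t']] := IHx t1.
- by move: le_x; rewrite sum_t1; lia.
- by rewrite /t1; case: eqP => // _; move: t_j; case: (t j) => [|[]].
- by rewrite -ltnS -sum_t1.
exists t'; split=> // i; apply: leq_trans (t'_le i) _.
by rewrite /t1; case: eqP => // ->; exact: leq_pred.
Qed.

Section Reach.
Set Implicit Arguments.
Unset Strict Implicit.
Variables (K : fieldType) (p n d k : nat) (u : 'I_n -> nat).
Hypotheses (charK : p \in [pchar K]) (n_gt0 : (0 < n)%N) (d_gt0 : (0 < d)%N).
Hypotheses (le_nk : (n <= k)%N) (le_kd : (k <= d)%N) (comp_u : compositions k u).
Local Notation mn := (multinom n).
Implicit Types (e s f M T c : nat) (t : 'I_n -> nat).

Let md := ideal_exp (max_ideal K n) d.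
Let p_gt1 : (1 < p)%N. Proof. exact/prime_gt1/(pcharf_prime charK). Qed.
Let p_gt0 : (0 < p)%N. Proof. exact: ltnW. Qed.

(* [t] is the slack p^e u - sum_i p^i v_i, or less: an inequality valid for
   every truncation [N] spares us from fixing the number of digits of M. *)
Definition reach e M T := exists (t : 'I_n -> nat) (v : nat -> mn),
  [/\ forall j, (0 < t j)%N, (\sum_(j < n) t j)%N = T,
      forall i, mdeg (v i) = (digit p M i * d)%N &
      forall N j, (t j + \sum_(i < N) v i j * p ^ i <= u j * p ^ e)%N].

Lemma reach0 : reach 0 0 k.
Proof.
have [u_gt0 sum_u] := comp_u; exists u, (fun=> @mnm0 n); split=> // [i|N j].
  by rewrite mdeg0 /digit div0n mod0n.
by rewrite big1 ?addn0 ?muln1 // => i _; rewrite mnm0E.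
Qed.

(** Multiplying everything by [p] shifts the digits of [M] up and turns the slack [t] into [p t].
    Lowering [p t] to a positive [t'] of degree [T'] frees degree [c * d], exactly what the new
    lowest digit [c] uses. *)
Lemma reachS e M T c T' : reach e M T -> (c < p)%N -> (n <= T')%N ->
  (T' + c * d = p * T)%N -> reach e.+1 (p * M + c) T'.
Proof.
move=> [t [v [t_gt0 sum_t deg_v le_u]]] c_lt le_nT eqT.
have sum_pt : (\sum_(j < n) p * t j = p * T)%N by rewrite -big_distrr sum_t.
have [j|||t' [t'_gt0 t'_le sum_t']] := @positive_below n T' (fun j => p * t j)%N.
- by rewrite muln_gt0 p_gt0 t_gt0.
- exact: le_nT.
- by rewrite sum_pt -eqT leq_addr.
pose v0 := mnm_sub (Multinom [tuple (p * t j)%N | j < n]) (Multinom [tuple t' j | j < n]).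
have v0E j : (v0 j = p * t j - t' j)%N by rewrite mnmBE !mnmE.
exists t', (fun i => if i is i'.+1 then v i' else v0); split=> // [[|i]|[|N] j].
- rewrite digit0 // mdegE; under eq_bigr do rewrite v0E.
  by rewrite sumnB // sum_pt sum_t' -eqT addKn.
- by rewrite digitS.
- rewrite big_ord0 addn0 (leq_trans (t'_le j)) // expnS mulnCA leq_mul2l.
  by apply/orP; right; have := le_u 0%N j; rewrite big_ord0 addn0.
rewrite big_ord_recl /= v0E muln1 addnA subnKC ?t'_le //.
under eq_bigr do rewrite expnS mulnCA.
by rewrite -big_distrr -mulnDr expnS mulnCA leq_mul2l le_u orbT.
Qed.

Lemma reach_not_sub e M T : reach e M T ->
  ~ (frob_power p md M `<=` bracket_power (diag K u) (p ^ e)).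
Proof.
move=> [t [v [t_gt0 _ deg_v le_u]]]; apply: frob_power_not_sub deg_v _ => // N j.
by apply: leq_trans (le_u N j); rewrite -addn1 addnC leq_add2r.
Qed.

Lemma not_sub_le s f M :
  ~ (frob_power p md M `<=` bracket_power (diag K u) (p ^ (s + f))) ->
  (M %/ p ^ f * d + n <= k * p ^ s)%N.
Proof.
move=> /(not_frob_power_sub charK); set N := (trunc_log p M).+1 => -[v [deg_v lt_u]].
have M_lt : (M < p ^ N)%N by exact: trunc_log_ltn.
have [_ <-] := comp_u; rewrite big_distrl /=.
pose w j := (\sum_(f <= i < N) v i j * p ^ (i - f))%N.
(* Without the terms below [f], the strict inequality in each coordinate can be divided by [p ^ f];
   between integers it leaves a gap of at least 1, and the [n] gaps give the summand [n]. *)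
apply: (@leq_trans (\sum_(j < n) (w j + 1))%N); last first.
  apply: leq_sum => j _; rewrite addn1 -(ltn_pmul2r (m := p ^ f)) ?expn_gt0 ?p_gt0 //.
  rewrite -mulnA -expnD; apply: leq_ltn_trans (lt_u j).
  rewrite big_distrl /= -(big_mkord xpredT (fun i => v i j * p ^ i)%N).
  have [le_fN|lt_Nf] := leqP f N; last by rewrite big_geq // ltnW.
  rewrite [leqRHS](big_cat_nat _ (n := f)) //= (leq_trans _ (leq_addl _ _)) //.
  rewrite big_nat_cond [leqRHS]big_nat_cond.
  by apply: leq_sum => i /andP[/andP[le_fi _] _]; rewrite -mulnA -expnD subnK.
rewrite big_split /= sum1_card card_ord leq_add2r exchange_big /=.
rewrite -(sum_digits _ _ M_lt) // big_distrl /=.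
rewrite big_nat_cond [leqRHS]big_nat_cond.
apply: leq_sum => i /andP[/andP[_ lt_iN] _]; rewrite -big_distrl /= -mdegE mulnAC.
by rewrite leq_mul2r deg_v ?orbT.
Qed.

Lemma mu_eq e M T : reach e M T ->
  (forall M', ~ (frob_power p md M' `<=` bracket_power (diag K u) (p ^ e)) ->
     (M' <= M)%N) ->
  mu p md (diag K u) (p ^ e) = M.
Proof.
move=> /reach_not_sub nsubM maxM; rewrite /mu /nat_max; apply: xget_unique => //.
by move=> M' [nsubM' maxM']; apply/eqP; rewrite eqn_leq maxM // maxM'.
Qed.

(* the m_e of the introduction *)
Definition quo e := ((k * p ^ e - lpr (k * p ^ e) d) %/ d)%N.

Lemma quoE e : (k * p ^ e = quo e * d + lpr (k * p ^ e) d)%N.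
Proof.
apply: lpr_divn_eq.
by rewrite muln_gt0 expn_gt0 p_gt0 (leq_trans n_gt0 le_nk).
Qed.

(** One step of the base [p] long division of [k] by [d], with remainders in [1..d] instead of
    [0..d-1]; [c] is the next digit of the nonterminating expansion of [k/d]. *)
Lemma quo_step e : exists c, [/\ (c < p)%N, quo e.+1 = (p * quo e + c)%N &
  (lpr (k * p ^ e.+1) d + c * d = p * lpr (k * p ^ e) d)%N].
Proof.
have r_gt0 := lpr_gt0 (k * p ^ e) d_gt0.
have rS_gt0 := lpr_gt0 (k * p ^ e.+1) d_gt0; have rS_le := lpr_le (k * p ^ e.+1) d_gt0.
have r_le := lpr_le (k * p ^ e) d_gt0.
have : ((quo e.+1) * d + lpr (k * p ^ e.+1) d =
    p * quo e * d + p * lpr (k * p ^ e) d)%N.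
  by rewrite -quoE -mulnA -mulnDr -quoE expnS mulnCA.
move: (quo e.+1) (quo e) (lpr _ _) (lpr _ _) r_gt0 rS_gt0 rS_le r_le => a b r r' r'_gt0 r_gt0 r_le r'_le eqa.
(* If [a < p * b], then [a * d + r <= p * b * d] because [r <= d], contradicting [p * r' > 0]. *)
have le_ba : (p * b <= a)%N.
  rewrite leqNgt; apply/negP => lt_ab.
  have : (a.+1 * d <= p * b * d)%N by rewrite leq_mul2r lt_ab orbT.
  by have : (0 < p * r')%N; [rewrite muln_gt0 p_gt0|rewrite mulSn; lia].
exists (a - p * b)%N; split; last 2 first.
- by rewrite subnKC.
- by rewrite mulnBl; move: (leq_mul le_ba (leqnn d)); lia.
(* A digit [c >= p] would give [p * d <= c * d = p * r' - r < p * d]. *)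
rewrite ltnNge; apply/negP => le_p.
have : (p * d <= (a - p * b) * d)%N by rewrite leq_mul2r le_p orbT.
by rewrite mulnBl; have := leq_mul (leqnn p) r'_le; move: (leq_mul le_ba (leqnn d)); lia.
Qed.

Lemma quo0 : quo 0 = 0%N.
Proof.
rewrite /quo muln1 lpr_small ?subnn ?div0n //.
by rewrite le_kd (leq_trans n_gt0 le_nk).
Qed.

Lemma reach_quo e :
  (forall i, (1 <= i <= e)%N -> (n <= lpr (k * p ^ i) d)%N) ->
  reach e (quo e) (lpr (k * p ^ e) d).
Proof.
elim: e => [|e IHe] le_n.
  rewrite quo0 muln1 lpr_small; first exact: reach0.
  by rewrite le_kd (leq_trans n_gt0 le_nk).
have [c [c_lt -> eqc]] := quo_step e.
apply: reachS eqc => //; last by apply: le_n; rewrite leqnn.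
by apply: IHe => i /andP[i1 ie]; apply: le_n; rewrite i1 ltnW.
Qed.

(** For maximality, the degree bound with [f = 0] gives [M' * d + n <= quo e * d + d], and [n > 0]
    makes [M' <= quo e]. *)
Lemma mu_quo e :
  (forall i, (1 <= i <= e)%N -> (n <= lpr (k * p ^ i) d)%N) ->
  mu p md (diag K u) (p ^ e) = quo e.
Proof.
move=> /reach_quo/mu_eq; apply=> M'; rewrite -[in (p ^ e)%N](addn0 e) => /not_sub_le.
rewrite divn1 quoE => le_M; rewrite leqNgt; apply/negP => lt_M.
have := leq_mul lt_M (leqnn d); have := lpr_le (k * p ^ e) d_gt0.
by rewrite mulSn; lia.
Qed.

(** A residue below [n] cannot be the degree of a positive slack, so the last digit is lowered by
    one and the slack grows by [d >= n]. Later digits [p - 1] preserve the form of the slack: [p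
    (p^f r + d) = (p^(f+1) r + d) + (p - 1) d]. *)
Lemma reach_quo_tail s f :
  (forall i, (1 <= i <= s)%N -> (n <= lpr (k * p ^ i) d)%N) ->
  (lpr (k * p ^ s.+1) d < n)%N ->
  (0 < quo s.+1)%N /\
  reach (s.+1 + f) (quo s.+1 * p ^ f - 1) (p ^ f * lpr (k * p ^ s.+1) d + d).
Proof.
move=> le_n lt_n; have le_nd := leq_trans le_nk le_kd.
(* The hypothesis starts at index 1; at index 0 the residue is [k] itself. *)
have le_ns : (n <= lpr (k * p ^ s) d)%N.
  case: s le_n {lt_n} => [|s] le_n; last by apply: le_n; rewrite leqnn.
  by rewrite muln1 lpr_small ?le_kd ?(leq_trans n_gt0).
(* The last digit can be lowered: if it were 0, the next residue would be [p] times the previous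
   one, hence at least [n]. *)
have [[|c] [c_lt quoS eqc]] := quo_step s.
  have : (lpr (k * p ^ s) d <= p * lpr (k * p ^ s) d)%N by rewrite leq_pmull.
  lia.
have quo_gt0 : (0 < quo s.+1)%N by rewrite quoS addnS.
split=> //; elim: f => [|f IHf].
  rewrite addn0 expn0 muln1 mul1n quoS addnS subn1 /=.
  apply: reachS (reach_quo le_n) _ _ _; first exact: ltnW.
    by rewrite (leq_trans le_nd) // leq_addl.
  by rewrite -eqc mulSn addnA.
rewrite addnS.
have -> : (quo s.+1 * p ^ f.+1 - 1 = p * (quo s.+1 * p ^ f - 1) + p.-1)%N.
  have : (0 < quo s.+1 * p ^ f)%N by rewrite muln_gt0 quo_gt0 expn_gt0 p_gt0.
  by move=> /(leq_pmulr p); rewrite expnS mulnCA mulnBr muln1; lia.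
apply: reachS IHf _ _ _; first by rewrite prednK.
  by rewrite (leq_trans le_nd) // leq_addl.
by rewrite -addnA -mulSn prednK // mulnDr mulnA expnS.
Qed.

(** For maximality, [M' >= quo s.+1 * p ^ f] would give [quo s.+1 <= M' %/ p ^ f], and the degree
    bound would then force [n] to be at most the residue at [s.+1]. *)
Lemma mu_quo_tail s f :
  (forall i, (1 <= i <= s)%N -> (n <= lpr (k * p ^ i) d)%N) ->
  (lpr (k * p ^ s.+1) d < n)%N ->
  (0 < quo s.+1)%N /\
  mu p md (diag K u) (p ^ (s.+1 + f)) = (quo s.+1 * p ^ f - 1)%N.
Proof.
move=> le_n lt_n; have [quo_gt0 reach_f] := reach_quo_tail f le_n lt_n.
split=> //; apply: mu_eq reach_f _ => M' /not_sub_le; rewrite quoE => le_M.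
have pf_gt0 : (0 < p ^ f)%N by rewrite expn_gt0 p_gt0.
rewrite leqNgt; apply/negP => lt_M.
have : (quo s.+1 <= M' %/ p ^ f)%N.
  rewrite leq_divRL //; move: lt_M.
  by have : (0 < quo s.+1 * p ^ f)%N; [rewrite muln_gt0 quo_gt0|lia].
by move=> /(leq_mul)/(_ (leqnn d)); lia.
Qed.

End Reach.

(** * Passage to the limit *)

Lemma nat_inf_spec (S : set nat) :
  match nat_inf S with
  | Some e => S e /\ forall i, S i -> (e <= i)%N
  | None => forall i, ~ S i
  end.
Proof.
rewrite /nat_inf; case: pselect => [h|nh] /=.
  case: ex_minnP => e /asboolP Se min_e; split=> // i Si.
  by apply: min_e; apply/asboolP.
by move=> i Si; apply: nh; exists i; apply/asboolP.
Qed.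

Lemma cvg_geometric_error (R : realType) (x : R^nat) (L : R) (p e0 : nat) :
  (1 < p)%N -> (forall e, (e0 <= e)%N -> `|x e - L| <= (p ^ e)%:R^-1) ->
  x @ \oo --> L.
Proof.
move=> p_gt1 le_err; pose z : R := p%:R^-1.
have p_gt0 : 0 < p%:R :> R by rewrite ltr0n ltnW.
have z0 : GRing.exp z @ \oo --> 0.
  by apply: cvg_expr; rewrite ger0_norm ?invr_ge0 ?(ltW p_gt0) // invf_lt1 // ltr1n.
apply: (@squeeze_cvgr _ _ _ _ (fun e => L - z ^+ e) (fun e => L + z ^+ e)).
- near=> e; have : (e0 <= e)%N by near: e; exact: nbhs_infty_ge.
  by move=> /le_err; rewrite natrX -exprVn ler_distl.
- by rewrite -[X in _ --> X]subr0; apply: cvgB z0; exact: cvg_cst.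
- by rewrite -[X in _ --> X]addr0; apply: cvgD z0; exact: cvg_cst.
Unshelve. all: by end_near. Qed.

(** With finite [s] the formula equals [quo s / p^s], and the error at [e >= s] is exactly [-1/p^e].
    With infinite [s] the error is [-r_e/(d p^e)], bounded by [1/p^e] since [r_e <= d]. *)
Lemma cvg_crit_seq (R : realType) (p : nat) (K : fieldType) (n d k : nat)
    (u : 'I_n -> nat) :
  p \in [pchar K] -> (0 < n)%N -> (0 < d)%N -> (n <= k)%N -> (k <= d)%N ->
  compositions k u ->
  crit_seq R p (ideal_exp (max_ideal K n) d) (diag K u) @ \oo -->
  crit_formula R p d k
    (nat_inf [set e | (1 <= e)%N /\ (lpr (k * p ^ e) d < n)%N]).
Proof.
move=> charK n_gt0 d_gt0 le_nk le_kd comp_u.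
have p_gt1 : (1 < p)%N by exact/prime_gt1/(pcharf_prime charK).
have p_gt0 : (0 < p)%N by exact: ltnW.
have d_neq0 : d%:R != 0 :> R by rewrite pnatr_eq0 -lt0n.
have pX_gt0 e : 0 < (p ^ e)%:R :> R by rewrite ltr0n expn_gt0 p_gt0.
have pX_neq0 e : (p ^ e)%:R != 0 :> R by rewrite lt0r_neq0.
have kE e : k%:R * (p ^ e)%:R = (quo p d k e)%:R * d%:R + (lpr (k * p ^ e) d)%:R :> R.
  by rewrite -!natrM -natrD -(@quoE K p n d k) // charK.
set S := [set e | _].
have le_n i : ~ S i -> (1 <= i)%N -> (n <= lpr (k * p ^ i) d)%N.
  by move=> nS i_ge1; rewrite leqNgt; apply/negP => lt_n; exact: nS.
(* The infimum is never 0, as [S] only contains positive indices; from here on the finite infimum is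
   [s.+1]. *)
case: (nat_inf S) (nat_inf_spec S) => [[|s]|] /=; first by move=> [[]].
  move=> [[_ lt_n] min_s]; apply: (@cvg_geometric_error _ _ _ p s.+1) => // e le_se.
  have -> : e = (s.+1 + (e - s.+1))%N by rewrite subnKC.
  rewrite /crit_seq; set f := (e - s.+1)%N.
  have [|quo_gt0 ->] := @mu_quo_tail K p n d k u charK n_gt0 d_gt0 le_nk le_kd comp_u s f _ lt_n.
    move=> i /andP[i_ge1 le_is]; apply: le_n => // /min_s.
    by rewrite ltnNge le_is.
  rewrite expnD natrB ?natrM; last by rewrite muln_gt0 quo_gt0 expn_gt0 p_gt0.
  rewrite (_ : _ - _ = - ((p ^ s.+1)%:R * (p ^ f)%:R)^-1).
    by rewrite normrN ger0_norm // invr_ge0 mulr_ge0 // ltW.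
  (* Eliminating the residue leaves a rational identity in independent quantities. *)
  have -> : (lpr (k * p ^ s.+1) d)%:R =
    k%:R * (p ^ s.+1)%:R - (quo p d k s.+1)%:R * d%:R :> R by rewrite kE addrC addKr.
  by field; rewrite d_neq0 !pX_neq0.
move=> noS; apply: (@cvg_geometric_error _ _ _ p 0) => // e _.
rewrite /crit_seq (@mu_quo K p n d k u) //; last by move=> i /andP[i_ge1 _]; exact: le_n.
rewrite (_ : _ - _ = - ((lpr (k * p ^ e) d)%:R / d%:R / (p ^ e)%:R)).
  rewrite normrN ger0_norm ?divr_ge0 // ler_pdivrMr // mulVf //.
  by rewrite ler_pdivrMr ?ltr0n // mul1r ler_nat lpr_le.
have -> : (lpr (k * p ^ e) d)%:R =
  k%:R * (p ^ e)%:R - (quo p d k e)%:R * d%:R :> R by rewrite kE addrC addKr.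
by field; rewrite d_neq0 pX_neq0.
Qed.

Theorem theorem3p6 (R : realType) (p : nat) (K : fieldType)
  (charK : p \in [pchar K]) (finK : finite_over_frobenius p K)
  (n d k : nat) (n_gt0 : (0 < n)%N) (d_gt0 : (0 < d)%N)
  (le_nk : (n <= k)%N) (le_kd : (k <= d)%N) :
  let s := nat_inf [set e | (1 <= e)%N /\ (lpr (k * p ^ e) d < n)%N] in
  let md := ideal_exp (max_ideal K n) d in
  (forall u : 'I_n -> nat, compositions k u ->
     cvgn (crit_seq R p md (diag K u)) /\
     crit R p md (diag K u) = crit_formula R p d k s)
  /\
  (forall u v : 'I_n -> nat, compositions k u -> compositions k v ->
     crit R p md (diag K u) = crit R p md (diag K v)).
Proof.
move=> s md; have cvg_u u : compositions k u ->
    crit_seq R p md (diag K u) @ \oo --> crit_formula R p d k s.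
  exact: cvg_crit_seq.
have crit_u u : compositions k u ->
    crit R p md (diag K u) = crit_formula R p d k s.
  by move=> /cvg_u; exact: cvg_lim.
split=> [u comp_u|u v comp_u comp_v]; last by rewrite !crit_u.
by split; [exact: cvgP (cvg_u u comp_u)|exact: crit_u].
Qed.
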